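(* For any integer $N\geq3$, there exists a subshift $\Sigma$ on $N$ symbols such that $0<h_{\rm spec}^\bot(\Sigma)<h_{\rm top}(\Sigma)$.
   Context: Subshifts and words. Let $A$ be a non-empty finite discrete set. A subshift over $A$, also called a subshift on $\#A$ symbols, is a non-empty closed shift-invariant subset $\Sigma$ of $A^{\mathbb N}$ (one-sided) or $A^{\mathbb Z}$ (two-sided), with the product topology. A word is a finite string of elements of $A$; $|w|$ is the length of the word $w$, and the empty word $\emptyset$ has length $0$. The language $\mathcal L(\Sigma)$ is the collection of the empty word and all words that appear in some element of $\Sigma$; $\mathcal L_n(\Sigma)$ is the set of its elements of length $n$. For $\mathcal D\subset\mathcal L(\Sigma)$ put $\mathcal D_n=\mathcal D\cap\mathcal L_n(\Sigma)$ and $h(\mathcal D)=\limsup_{n\to\infty}\frac1n\log\max\{1,\#\mathcal D_n\}$. Then $h_{\rm top}(\Sigma)=h(\mathcal L(\Sigma))$ is the topological entropy. $\mathbb N$ denotes the positive integers. Decompositions. For $\mathcal C^p,\mathcal G,\mathcal C^s\subset\mathcal L(\Sigma)$, the notation $\mathcal L(\Sigma)=\mathcal C^p\mathcal G\mathcal C^s$ means that every word in $\mathcal L(\Sigma)$ can be written as a concatenation $uvw$ with $u\in\mathcal C^p$, $v\in\mathcal G$, $w\in\mathcal C^s$. For $M\in\mathbb N$ put $\mathcal G^M=\{uvw\in\mathcal L(\Sigma)\colon u\in\mathcal C^p, v\in\mathcal G, w\in\mathcal C^s, |u|,|w|\leq M\}$. (W)-specification. A collection $\mathcal G\subset\mathcal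 L(\Sigma)$ has (W)-specification if there is an integer $t\geq0$ (a gap size) such that for all $m\geq2$ and all $v^{(1)},\ldots,v^{(m)}\in\mathcal G$ there exist $w^{(1)},\ldots,w^{(m-1)}\in\mathcal L(\Sigma)$ with $v^{(1)}w^{(1)}v^{(2)}w^{(2)}\cdots w^{(m-1)}v^{(m)}\in\mathcal L(\Sigma)$ and $|w^{(i)}|\leq t$ for all $i$. The obstruction entropy to specification on $\Sigma$ is $$h_{\rm spec}^\bot(\Sigma)=\inf\{h(\mathcal C^p\cup\mathcal C^s)\colon \mathcal L(\Sigma)=\mathcal C^p\mathcal G\mathcal C^s\text{ and }\mathcal G^M\text{ has (W)-specification for all }M\in\mathbb N\}.$$ *)

(* Defs.v *)
From HB Require Import structures.
From mathcomp Require Import all_boot all_order all_algebra.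
From mathcomp Require Import all_classical all_reals all_analysis.

Set Implicit Arguments.
Unset Strict Implicit.
Unset Printing Implicit Defensive.

Import Order.TTheory GRing.Theory Num.Theory.

Local Open Scope classical_set_scope.
Local Open Scope ring_scope.

Section Subshift.
Variable A : finType.

(* Used with I = nat (one-sided) and I = int (two-sided). *)
Definition shift_map (I : pzSemiRingType) (x : I -> A) : I -> A :=
  fun i => x (i + 1).

(* Invariance is sigma(X) `<=` X in the one-sided case, where sigma is not
   invertible, and sigma(X) = X in the two-sided case, where it is. One-sided
   sequences are indexed from 0 rather than from 1. *)
Variant subshift : Type :=
| OneSided (X : set (nat -> A)) of X !=set0
    & closed (X : set {ptws nat -> discrete_topology A})
    & @shift_map nat @` X `<=` X
| TwoSided (X : set (int -> A)) of X !=set0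
    & closed (X : set {ptws int -> discrete_topology A})
    & @shift_map int @` X = X.

Definition appears_in (I : pzSemiRingType) (x : I -> A) (w : seq A) : Prop :=
  exists i : I, w = mkseq (fun k => x (i + k%:R)) (size w).

Definition language (S : subshift) : set (seq A) :=
  [set w | w = [::] \/
    match S with
    | OneSided X _ _ _ => exists2 x, X x & appears_in x w
    | TwoSided X _ _ _ => exists2 x, X x & appears_in x w
    end].

Definition nb_words (D : set (seq A)) (n : nat) : nat :=
  #|[set w : n.-tuple A | `[< D w >]]|%SET.

(* The term n = 0 is 0, since 0^-1 = 0; it does not affect the limsup. *)
Definition entropy (R : realType) (D : set (seq A)) : \bar R :=
  limn_esup (fun n => (n%:R^-1 * ln (maxn 1 (nb_words D n))%:R)%:E).

Definition htop (R : realType) (S : subshift) : \bar R :=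
  entropy R (language S).

Definition decomposes (L Cp G Cs : set (seq A)) : Prop :=
  [/\ Cp `<=` L, G `<=` L, Cs `<=` L &
    forall x, L x ->
      exists u v w, [/\ Cp u, G v, Cs w & x = u ++ v ++ w]].

Definition thicken (L Cp G Cs : set (seq A)) (M : nat) : set (seq A) :=
  [set x | L x /\ exists u v w,
    [/\ Cp u, G v, Cs w, x = u ++ v ++ w & (size u <= M)%N && (size w <= M)%N]].

(* The words v_0, ..., v_{m-1} to be glued and the gap words w_0, ..., w_{m-2}
   are the initial values of sequences; the other values are irrelevant. *)
Definition Wspecification (L G : set (seq A)) : Prop :=
  exists t : nat, forall (m : nat) (v : nat -> seq A), (2 <= m)%N ->
    (forall i, (i < m)%N -> G (v i)) ->
    exists w : nat -> seq A,
      (forall i, (i < m.-1)%N -> L (w i) /\ (size (w i) <= t)%N) /\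
      L (v 0%N ++ flatten (mkseq (fun i => w i ++ v i.+1) m.-1)).

(* The infimum is taken in \bar R, so it is +oo if no triple is admissible. *)
Definition hspec (R : realType) (S : subshift) : \bar R :=
  let L := language S in
  ereal_inf [set h | exists Cp G Cs : set (seq A),
    [/\ decomposes L Cp G Cs,
        forall M, (0 < M)%N -> Wspecification L (thicken L Cp G Cs M)
      & h = entropy R (Cp `|` Cs)]].

End Subshift.

(* Main.v *)
(* The example consists of the sequences over {0, 1, 2} in which a maximal block
   over {0, 1} preceded by 2^k, itself preceded by a letter of {0, 1}, has
   length at most k + 1.
   - Words 2ab with a, b arbitrary concatenate freely, so the entropy is at
     least (log 9) / 3 > log 2.
   - A word is an initial 2^k b with b over {0, 1}, followed by a word starting
     with 2 that may be glued after anything. The initial parts have entropy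
     log 2, and those of length at most M are harmless after a gap 2^M.
   - Gluing long words over {0, 1} after a word containing 2 requires long gaps.
     So if G has specification, either the words of G over {0, 1} have bounded
     length, or no word of G contains 2. In the first case the words
     0 b_1 0 b_2 ..., in the second the words 2 b_1 2 b_2 ..., with b_i in
     {0, 1}, have only short factors in G: the prefixes and suffixes must
     produce this positive entropy. *)
Require Import Defs.
From mathcomp Require Import all_boot all_order all_algebra.
From mathcomp Require Import all_classical all_reals all_analysis.
From mathcomp Require Import zify ring lra.

Set Implicit Arguments.
Unset Strict Implicit.
Unset Printing Implicit Defensive.

Import Order.TTheory GRing.Theory Num.Theory.

Local Open Scope classical_set_scope.
Local Open Scope nat_scope.

(** * Counting words through codes of their factors *)

Section Counting.
Variable A : finType.
Implicit Types (D C : set (seq A)) (w : seq A).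

Lemma nb_words_le (T : finType) (f : T -> seq A) D n :
  (forall w, D w -> size w = n -> exists t, f t = w) -> nb_words D n <= #|T|.
Proof.
move=> fD; rewrite /nb_words -(card_imset _ (@Some_inj _)).
(* [insub] discards the values of [f] of the wrong length. *)
pose g t : option (n.-tuple A) := insub (f t).
apply: leq_trans (leq_imset_card g _).
apply/subset_leq_card/fintype.subsetP => _ /imsetP[w + ->].
rewrite inE => /asboolP /fD /(_ (size_tuple w))[t ft].
by apply/imsetP; exists t => //; rewrite /g ft valK.
Qed.

Lemma nb_words_ge (T : finType) (f : T -> seq A) D n :
  injective f -> (forall t, size (f t) = n) -> (forall t, D (f t)) ->
  #|T| <= nb_words D n.
Proof.
move=> finj fn fD; pose g t : n.-tuple A := Tuple (introT eqP (fn t)).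
have ginj : injective g by move=> s t /(congr1 val) /finj.
rewrite -(card_imset _ ginj).
apply/subset_leq_card/fintype.subsetP => _ /imsetP[t _ ->].
by rewrite inE; apply/asboolP; exact: fD.
Qed.

(** Coding a word of [D] by its index costs [nb_words D n] codes instead of [#|A| ^ n]. *)
Definition nth_word D n (i : nat) : seq A :=
  nth [::] [seq val w | w : n.-tuple A in [set w | `[< D (val w) >]]%SET] i.

Lemma nth_wordP D w :
  D w -> exists2 i, i < nb_words D (size w) & nth_word D (size w) i = w.
Proof.
move=> Dw; set s := [seq val w |
  w : (size w).-tuple A in [set w | `[< D (val w) >]]%SET].
have ws : w \in s.
  apply/fintype.imageP; exists (in_tuple w) => //.
  by rewrite inE; apply/asboolP.
exists (index w s); last by rewrite /nth_word nth_index.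
by have := ws; rewrite -index_mem size_map -cardE.
Qed.

(** Each outer factor is coded by its length and index, the middle one by its length and its padding
    with [a0] to length [K]. *)
Lemma nb_words_cat3_le (a0 : A) D C n Q K :
  (forall k, k <= n -> nb_words C k <= Q) ->
  (forall x, D x -> size x = n -> exists u v w,
    [/\ C u, C w, size v <= K & x = u ++ v ++ w]) ->
  nb_words D n <= (n.+1 * Q) * (K.+1 * #|A| ^ K) * (n.+1 * Q).
Proof.
move=> CQ DC.
pose f (t : ('I_n.+1 * 'I_Q) * ('I_K.+1 * K.-tuple A) * ('I_n.+1 * 'I_Q)) :=
  nth_word C t.1.1.1 t.1.1.2 ++ take t.1.2.1 t.1.2.2 ++ nth_word C t.2.1 t.2.2.
have := @nb_words_le _ f D n; rewrite !card_prod !card_ord card_tuple; apply.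
move=> x /DC xD xn; have [u [v [w [Cu Cw vK xE]]]] := xD xn.
have [i iC iu] := nth_wordP Cu; have [j jC jw] := nth_wordP Cw.
have := xn; rewrite xE !size_cat => sn.
have un : size u < n.+1 by lia.
have wn : size w < n.+1 by lia.
have iQ := leq_trans iC (CQ _ un); have jQ := leq_trans jC (CQ _ wn).
have [a aE] : exists a : K.-tuple A, take (size v) a = v.
  have sa : size (v ++ nseq (K - size v) a0) == K.
    by rewrite size_cat size_nseq subnKC.
  by exists (Tuple sa); rewrite /= take_size_cat.
have vK' : size v < K.+1 by [].
exists (Ordinal un, Ordinal iQ, (Ordinal vK', a), (Ordinal wn, Ordinal jQ)).
by rewrite /f /= iu jw aE.
Qed.

Lemma nb_words_max D k : nb_words D k <= #|A| ^ k.
Proof. by rewrite -card_tuple; exact: max_card. Qed.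

(** If [C] grew at rate at most 1/16 in base 2, two factors from [C] and the choice of their lengths
    would yield only about [2 ^ (4 * B)] words of length [16 * B], against the [2 ^ (8 * B)] of
    [D]. *)
Lemma short_middle_growth (a0 : A) D C m K :
  (forall j, 2 ^ (8 * j) <= nb_words D (16 * j)) ->
  (forall x, D x -> exists u v w,
    [/\ C u, C w, size v <= K & x = u ++ v ++ w]) ->
  exists2 k, m <= k & 2 ^ k < nb_words C k ^ 16.
Proof.
move=> Dbig DC; apply/not_exists2P => Csmall.
have {}Csmall k : m <= k -> nb_words C k ^ 16 <= 2 ^ k.
  by move=> mk; case: (Csmall k) => [//|/negP]; rewrite -leqNgt.
set c := #|A|; have c0 : 0 < c by apply/card_gt0P; exists a0.
(* [B] is the product of all constant factors of the upper bound, which thus becomes exactly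
   [B * 2 ^ (4 * B)]. *)
pose B := 256 * c ^ m.*2 * (K.+1 * c ^ K).
(* The factor [c ^ m] covers the lengths below [m], the factor [2 ^ B] those from [m] to
   [16 * B]. *)
pose Q := c ^ m * 2 ^ B.
have CQ k : k <= 16 * B -> nb_words C k <= Q.
  move=> kB; have [km|mk] := ltnP k m.
    apply: leq_trans (nb_words_max C k) _.
    by rewrite -[leqLHS]muln1 leq_mul ?expn_gt0// leq_pexp2l// ltnW.
  rewrite -[leqLHS]mul1n leq_mul ?expn_gt0 ?c0//.
  rewrite -(leq_exp2r _ _ (isT : 0 < 16)) -expnM mulnC.
  by apply: leq_trans (Csmall k mk) _; rewrite leq_exp2l.
have := leq_trans (Dbig B) (nb_words_cat3_le a0 CQ (fun x Dx _ => DC x Dx)).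
have B16 : (16 * B).+1 <= 16 * 2 ^ B.
  by apply: (@leq_trans (16 * B.+1)); [lia|rewrite leq_mul// ltn_expl].
apply/negP; rewrite -ltnNge -/c.
apply: (@leq_ltn_trans (16 * 2 ^ B * Q * (K.+1 * c ^ K) * (16 * 2 ^ B * Q))).
  by rewrite !leq_mul.
have -> : 16 * 2 ^ B * Q * (K.+1 * c ^ K) * (16 * 2 ^ B * Q) = B * 2 ^ (4 * B).
  rewrite [4 * B]mulnC expnM /Q; move: (2 ^ B) => x.
  by rewrite /B -addnn expnD; ring.
have -> : 8 * B = 4 * B + 4 * B by lia.
rewrite expnD ltn_mul2r expn_gt0 /=.
apply: (leq_trans (ltn_expl B (isT : 1 < 2))).
by rewrite leq_exp2l// leq_pmull.
Qed.

End Counting.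

(** * Entropy bounds from word counts *)

Section Entropy.
Local Open Scope ring_scope.
Variables (R : realType) (A : finType).
Implicit Types (D : set (seq A)) (c : R).

Lemma entropy_le D c m : (0 < m)%N ->
  (forall k, (m <= k)%N -> ln (maxn 1 (nb_words D k))%:R <= c * k%:R) ->
  (entropy R D <= c%:E)%E.
Proof.
move=> m0 Dc; rewrite /entropy /limn_esup /limf_esup.
apply: ge_ereal_inf; eexists.
  by exists [set k | (m <= k)%N] => //; exact: nbhs_infty_ge.
apply: ge_ereal_sup => _ [k /= mk <-]; rewrite lee_fin mulrC ler_pdivrMr.
  exact: Dc.
by rewrite ltr0n (leq_trans m0).
Qed.

Lemma entropy_ge D c :
  (forall m, exists k, [/\ (0 < k)%N, (m <= k)%N &
    c * k%:R <= ln (maxn 1 (nb_words D k))%:R]) ->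
  (c%:E <= entropy R D)%E.
Proof.
move=> Dc; apply: le_ereal_inf_tmp => _ [V [m _ mV] <-].
have [k [k0 mk ck]] := Dc m.
apply: (@le_trans _ _ (k%:R^-1 * ln (maxn 1 (nb_words D k))%:R)%:E).
  by rewrite lee_fin mulrC ler_pdivlMr// ltr0n.
by apply: ereal_sup_ubound; exists k => //; exact: mV.
Qed.

Lemma entropy_lt D c : (entropy R D < c%:E)%E ->
  exists m, forall k, (m <= k)%N -> ln (maxn 1 (nb_words D k))%:R <= c * k%:R.
Proof.
move=> /ereal_inf_lt[_ [V [m _ mV] <-] Vc]; exists m.+1 => k mk.
have k0 : (0 < k)%N by lia.
rewrite mulrC -ler_pdivrMl ?ltr0n// -lee_fin; apply: le_trans (ltW Vc).
by apply: ereal_sup_ubound; exists k => //; apply: mV => /=; lia.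
Qed.

End Entropy.

Lemma seq_span (T : Type) (p : pred T) (s : seq T) :
  exists s1 s2, [/\ s = s1 ++ s2, all p s1 &
    if s2 is a :: _ then ~~ p a else true].
Proof.
elim: s => [|a s [s1 [s2 [-> s1p s2p]]]]; first by exists [::], [::].
by case: (boolP (p a)) => pa;
  [exists (a :: s1), s2|exists [::], (a :: s1 ++ s2)]; split=> //=; rewrite pa.
Qed.

(** * The subshift, its language and gluing *)

Section Example.
Variable n : nat.
Implicit Types (u v w x y : seq 'I_n.+3) (z : nat -> 'I_n.+3).

Definition zero : 'I_n.+3 := @Ordinal n.+3 0 isT.
Definition two : 'I_n.+3 := @Ordinal n.+3 2 isT.

(* If [q] is the last position before [p] with a letter of [{0, 1}], the
   conclusion reads [r - p <= (p - q) + 1]: a block after [2^k] has length at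
   most [k + 1]. Earlier [q] give weaker conditions, and a block whose preceding
   [2]'s extend to the left end is unrestricted. *)
Definition admissible z : Prop :=
  (forall i, z i <= 2) /\
  forall q p r, q < p < r -> z q < 2 -> z p = two ->
    (forall s, p < s <= r -> z s < 2) -> r + q <= p.*2.+1.

Lemma admissible_two : admissible (fun=> two).
Proof. by split=> // q p r _ /=. Qed.

Lemma admissible_shift z k : admissible z -> admissible (fun i => z (k + i)).
Proof.
move=> [z2 zP]; split=> // q p r qpr zq zp zs.
have := zP (k + q) (k + p) (k + r).
move=> /(_ _ zq zp); have H1 : k + q < k + p < k + r by lia.
have H2 s : k + p < s <= k + r -> z s < 2.
  by move=> ?; have := zs (s - k); rewrite subnKC; [apply|]; lia.
by move=> /(_ H1 H2); lia.
Qed.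

(** Padding with 2's creates no new constraint: [r] has to carry a letter below 2, so it lies before
    [m]. *)
Lemma admissible_trunc z m :
  admissible z -> admissible (nth two (mkseq z m)).
Proof.
move=> [z2 zP].
have E i : i < m -> nth two (mkseq z m) i = z i by move=> ?; rewrite nth_mkseq.
have F i : m <= i -> nth two (mkseq z m) i = two.
  by move=> ?; rewrite nth_default// size_mkseq.
split=> [i|q p r qpr].
  by case: (ltnP i m) => im; [rewrite E|rewrite F].
have [rm|mr] := ltnP r m; last first.
  move=> _ _ /(_ r); rewrite F// leqnn andbT.
  by case/andP: qpr => _ -> /(_ isT).
rewrite !E; try lia; move=> zq zp zs; apply: zP zq zp _ => // s sr.
by have := zs s sr; rewrite E//; lia.
Qed.

(** Each condition involves finitely many coordinates, so it passes to a limit from a point agreeing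
    far enough. *)
Lemma closed_admissible :
  closed (admissible : set {ptws nat -> discrete_topology 'I_n.+3}).
Proof.
move=> z zX.
have {}zX m : exists2 y, admissible y & forall i, i < m -> z i = y i.
  have Fz := @nbhs_filter {ptws nat -> discrete_topology 'I_n.+3} z.
  have : nbhs (z : {ptws nat -> discrete_topology 'I_n.+3})
      [set y : nat -> 'I_n.+3 | forall i, i < m -> z i = y i].
    elim: m => [|m IH]; first by apply: filterE => y i; rewrite ltn0.
    have : nbhs (z : {ptws nat -> discrete_topology 'I_n.+3})
      [set y : nat -> 'I_n.+3 | z m = y m].
      have := @proj_continuous nat (fun=> discrete_topology 'I_n.+3) m z.
      by apply; rewrite nbhs_principalE; apply/principal_filterP.
    apply: filterS2 IH => y yz yz' i; rewrite ltnS leq_eqVlt => /orP[/eqP->//|].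
    exact: yz.
  by move=> /zX[y [Xy zy]]; exists y.
split=> [i|q p r qpr zq zp zs].
  by have [y [y2 _] /(_ i (ltnSn i)) ->] := zX i.+1.
have [y [_ yP] zy] := zX r.+1; apply: (yP q p r) => //.
- by rewrite -zy//; lia.
- by rewrite -zy//; lia.
- by move=> s sr; rewrite -zy ?zs//; lia.
Qed.

Lemma shift_admissible :
  @shift_map _ nat @` (admissible : set (nat -> 'I_n.+3)) `<=` admissible.
Proof.
move=> _ [z zX <-]; have := admissible_shift 1 zX.
by congr admissible; apply/funext => i; rewrite addnC.
Qed.

Definition thin_shift : subshift 'I_n.+3 :=
  OneSided (ex_intro _ _ admissible_two) closed_admissible shift_admissible.

Local Notation L := (language thin_shift).

(** One extension suffices as a test: the default value of [nth] pads [w] with 2's. *)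
Lemma languageE w : L w <-> admissible (nth two w).
Proof.
split=> [[->|[z zX [i ->]]]|wX].
- by have -> : nth two [::] = fun=> two by apply/funext => i; rewrite nth_nil.
- apply: admissible_trunc.
  have := admissible_shift i zX.
  by congr admissible; apply/funext => k; rewrite natn.
- right; exists (nth two w) => //; exists 0.
  rewrite -[LHS](mkseq_nth two); apply: eq_mkseq => i.
  by rewrite add0r natn.
Qed.

Lemma language_suffix x y : L (x ++ y) -> L y.
Proof.
move=> /languageE /(admissible_shift (size x)) xy; apply/languageE.
move: xy; congr admissible; apply/funext => i.
by rewrite nth_cat ltnNge leq_addr /= addKn.
Qed.

Lemma language_replace_head (c : 'I_n.+3) y :
  c < 2 -> L (c :: y) -> L (zero :: y).
Proof.
move=> c2 /languageE[y2 yP]; apply/languageE.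
split=> [[//|i]|q p r qpr zq zp zs]; first exact: (y2 i.+1).
apply: (yP q p r) => //.
- by case: q zq {qpr}.
- by case: p zp qpr {zs}.
- by move=> [//|s] sr; exact: (zs s.+1 sr).
Qed.

(* [zero :: y] records that [y] may follow a letter of [{0, 1}]; starting with
   [2], [y] cannot prolong a block of [x]. *)
Lemma language_glue x y :
  L x -> L (zero :: y) -> nth two y 0 = two -> L (x ++ y).
Proof.
move=> /languageE[x2 xP] /languageE[y2 yP] y0; apply/languageE.
have E1 i : i < size x -> nth two (x ++ y) i = nth two x i.
  by move=> ix; rewrite nth_cat ix.
have E2 i : size x <= i -> nth two (x ++ y) i = nth two y (i - size x).
  by move=> ix; rewrite nth_cat ltnNge ix.
split=> [i|q p r qpr].
  by case: (ltnP i (size x)) => ix; [rewrite E1|rewrite E2//; exact: (y2 _.+1)].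
have [rx|xr] := ltnP r (size x).
  rewrite !E1; try lia; move=> zq zp zs; apply: xP zq zp _ => // s sr.
  by have := zs s sr; rewrite E1//; lia.
have [px|xp] := ltnP p (size x).
  by move=> _ _ /(_ (size x)); rewrite E2// subnn y0 px xr => /(_ isT).
rewrite [nth _ _ p]E2// => zq zp zs.
have {}zs s : (p - size x).+1 < s <= (r - size x).+1 ->
    nth two (zero :: y) s < 2.
  case: s => [//|s] sr; have := zs (size x + s).
  by rewrite E2 ?leq_addr// addKn; apply; lia.
(* For [q] inside [x], the leading [zero] stands for position [size x - 1], which is at least [q]
   and so gives the stronger bound. *)
have [qx|xq] := ltnP q (size x).
  by have := yP 0 (p - size x).+1 (r - size x).+1 ltac:(lia) isT zp zs; lia.
rewrite E2// in zq.
by have := yP (q - size x).+1 (p - size x).+1 (r - size x).+1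
  ltac:(lia) zq zp zs; lia.
Qed.

(** * A decomposition whose middle part has specification *)

Definition binary w := all (fun a : 'I_n.+3 => a < 2) w.

(** The gap [nseq M two] alone allows a block of length [M + 1]; the [k] further 2's are those of
    the head word itself. *)
Lemma language_prefix M k b : binary b -> size b <= M ->
  L (zero :: nseq M two ++ nseq k two ++ b).
Proof.
move=> bb bM; rewrite catA -nseqD; apply/languageE.
set m := M + k.
have E i : nth two (zero :: nseq m two ++ b) i =
    if i is j.+1 then if j < m then two else nth two b (j - m) else zero.
  by case: i => //= j; rewrite nth_cat size_nseq nth_nseq if_same.
have b2 i : nth two b i <= 2.
  have [ib|bi] := ltnP i (size b); last by rewrite nth_default.
  by rewrite ltnW// (allP bb)// mem_nth.
split=> [[|i]|q p r qpr]; rewrite !E//; first by case: ifP.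
(* Letters below 2 occupy only position 0 and the positions from [m + 1] to [m + size b]. Hence
   [r <= m + size b], [m <= p] and [q = 0]. *)
move=> zq zp zs.
have rm : r.-1 < m + size b.
  rewrite ltnNge; apply/negP => mr; have := zs r; rewrite E.
  case: r qpr mr {zs} => [|r] /= qpr mr; first by lia.
  rewrite [r < m]ltnNge (leq_trans (leq_addr _ _) mr)/=.
  rewrite nth_default; last by lia.
  by rewrite /= ltnn => H; suff: false by []; apply: H; lia.
have pm : m <= p.
  rewrite leqNgt; apply/negP => pm; have := zs p.+1; rewrite E.
  by rewrite pm => H; suff: false by []; apply: H; lia.
have q0 : q = 0.
  case: q qpr zq => [//|q] qpr; have [//|mq] := ltnP q m.
  case: p qpr zp {zs pm} => [|p] qpr; first by lia.
  rewrite ltnNge; have -> /= : m <= p by lia.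
  move=> zp _.
  have [pb|bp] := ltnP (p - m) (size b); last by lia.
  by have := allP bb _ (mem_nth two pb); rewrite zp.
by lia.
Qed.

(** Every gap is the same word [nseq M two]; the words are glued one at a time by [language_glue],
    where [0 < M] makes each new piece start with 2. *)
Lemma Wspecification_gap (M : nat) (G : set (seq 'I_n.+3)) :
  0 < M ->
  (forall x, G x -> L x /\ L (zero :: nseq M two ++ x)) -> Wspecification L G.
Proof.
move=> M0 GL; exists M => m v m2 Gv; exists (fun=> nseq M two).
have L2 : L (nseq M two).
  have := @language_prefix M 0 [::] isT isT; rewrite /= cats0.
  exact: (@language_suffix [:: zero]).
split=> [i _|]; first by rewrite size_nseq.
have: m.-1 <= m.-1 by [].
elim: {1 3}m.-1 => [|k IH] km.
  by rewrite cats0; apply: (GL _ _).1; apply: Gv; lia.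
rewrite mkseqS flatten_rcons catA; apply: language_glue.
- by apply: IH; lia.
- by apply: (GL _ _).2; apply: Gv; lia.
- by case: M M0 {GL L2 IH}.
Qed.

Definition head_word : set (seq 'I_n.+3) :=
  [set x | exists k b, binary b /\ x = nseq k two ++ b].

(** By [language_glue] these words may follow any word of the language. The default [two] admits the
    empty word. *)
Definition tail_word : set (seq 'I_n.+3) :=
  [set x | L (zero :: x) /\ nth two x 0 = two].

Lemma head_tail w :
  L w -> exists u v, [/\ head_word u, tail_word v & w = u ++ v].
Proof.
move=> wL.
have [a [w' [ew a2 w'2]]] := seq_span (fun c : 'I_n.+3 => c == two) w.
have [b [v [ew' bb v2]]] := seq_span (fun c : 'I_n.+3 => c < 2) w'.
exists (a ++ b), v; split; last by rewrite -catA -ew'.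
  by exists (size a), b; split=> //; congr (_ ++ _); apply/all_pred1P.
have v0 : nth two v 0 = two.
  have [w2 _] : admissible (nth two w) by exact/languageE.
  case: v v2 ew' => [//|c v] /= c2 ew'; apply/val_inj => /=.
  have := w2 (size a + size b).
  rewrite ew ew' catA nth_cat size_cat ltnn subnn /=.
  by move: c2; lia.
(* If [b] is empty, so is [v], since the run [a] of 2's is maximal. Otherwise the last letter [c] of
   [b] precedes [v] in [w] and may be turned into [zero]. *)
split=> //; case: (lastP b) bb ew' => [_ ew'|b' c].
  case: v v2 ew' v0 => [_ _ _|c v c2 /= ew' v0].
    by have := @language_prefix 0 0 [::] isT isT.
  by move: w'2; rewrite ew' -v0 eqxx.
rewrite /binary all_rcons => /andP[c2 _] ew'.
apply: language_replace_head c2 _; move: wL.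
by rewrite ew ew' cat_rcons catA; exact: language_suffix.
Qed.

Lemma head_word_language x : head_word x -> L x.
Proof.
move=> [k [b [bb ->]]].
have := language_prefix k bb (leqnn _).
by rewrite -cat_cons; exact: language_suffix.
Qed.

Lemma tail_word_language x : tail_word x -> L x.
Proof. by case=> + _; exact: (@language_suffix [:: zero]). Qed.

Lemma decomposes_head_tail : decomposes L head_word tail_word [set [::]].
Proof.
split=> [x|x|x ->|x /head_tail[u [v [ux vx ->]]]].
- exact: head_word_language.
- exact: tail_word_language.
- by left.
- by exists u, v, [::]; rewrite cats0.
Qed.

Lemma Wspecification_thicken M : 0 < M ->
  Wspecification L (thicken L head_word tail_word [set [::]] M).
Proof.
move=> M0; apply: (Wspecification_gap M0) => x [xL].
move=> [_ [v [w [[k [b [bb ->]]] [v0L v0] -> ex /andP[uM _]]]]].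
split=> //; rewrite ex.
rewrite cats0 catA -cat_cons; apply: language_glue => //.
apply: language_prefix => //; apply: leq_trans uM.
by rewrite size_cat leq_addl.
Qed.

(** * Periodically marked words *)

Section Blocks.
Variables (d m : nat) (mn : m <= n.+3).
Implicit Types (c : 'I_n.+3) (s : seq (d.-tuple 'I_m)).

(** Used with [d = 1], [m = 2] to bound [hspec] from below, and with [d = 2], [m = 3] to bound
    [htop] from below. *)
Definition block_word c s :=
  flatten [seq c :: map (widen_ord mn) t | t : d.-tuple 'I_m <- s].

Lemma size_block_word c s : size (block_word c s) = size s * d.+1.
Proof.
by elim: s => //= t s IH; rewrite size_cat /= size_map size_tuple IH mulSn.
Qed.

Lemma block_word_inj c k :
  injective (fun s : k.-tuple (d.-tuple 'I_m) => block_word c s).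
Proof.
move=> [s sk] [s' s'k] /= ss'; apply: val_inj => /=.
move/eqP: sk; move/eqP: s'k ss' => <-.
elim: s s' => [|t s IH] [|t' s'] //= /eqP.
rewrite eqseq_cons eqseq_cat ?size_map ?size_tuple//.
move=> /and3P[_ /eqP tt' /eqP ss'] [sk]; congr (_ :: _); last exact: IH.
by apply/val_inj/(inj_map _ tt') => i j /(congr1 val) ij; exact: val_inj.
Qed.

Lemma all_block_word (P : pred 'I_n.+3) c s :
  P c -> (forall i, P (widen_ord mn i)) -> all P (block_word c s).
Proof.
move=> Pc Pm; elim: s => //= t s IH; rewrite Pc all_cat IH andbT /=.
by rewrite all_map; apply/allP => i _ /=.
Qed.

(** Past the end of the word this holds through the default [two]. *)
Lemma nth_block_word s i : d.+1 %| i -> nth two (block_word two s) i = two.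
Proof.
elim: s i => [|t s IH] [|i] di //=.
have id : d.+1 <= i.+1 by exact: dvdn_leq.
rewrite nth_cat size_map size_tuple ltnNge (_ : d <= i)//=; apply: IH.
by rewrite -subSS dvdn_sub.
Qed.

(** A 2 recurs every [d + 1] letters, so [r <= p + 2], and [q <= p - 1] gives the bound. *)
Lemma language_block_word s : d <= 2 -> m <= 3 -> L (block_word two s).
Proof.
move=> d2 m3; apply/languageE; split=> [i|q p r qpr zq zp zs].
  have [ib|bi] := ltnP i (size (block_word two s)); last by rewrite nth_default.
  have s2 : all (fun a : 'I_n.+3 => a <= 2) (block_word two s).
    by apply: all_block_word => // j /=; rewrite -ltnS (leq_trans (ltn_ord j)).
  by apply: (allP s2); rewrite mem_nth.
have rpd : r <= p + d; last by lia.
rewrite leqNgt; apply/negP => rpd.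
(* This is the first multiple of [d + 1] after [p]; it is at most [p + d + 1], hence at most [r]. *)
have := zs ((p %/ d.+1).+1 * d.+1); rewrite nth_block_word ?dvdn_mull//.
have := divn_eq p d.+1; have := @ltn_pmod p d.+1 isT.
by move=> p1 p2 H; suff: false by []; apply: H; lia.
Qed.

End Blocks.

(** * Constraints imposed by specification *)

Lemma block_word_factor s u v w : @block_word 1 2 isT two s = u ++ v ++ w ->
  two \notin v -> size v <= 1.
Proof.
move=> sE v2; rewrite leqNgt; apply/negP => v1.
(* Even positions carry 2, and one of two consecutive positions is even. *)
have vE i : i < size v -> ~~ (2 %| size u + i).
  move=> iv; apply/negP => /(@nth_block_word 1 2 isT s); rewrite sE.
  rewrite nth_cat ltnNge leq_addr addKn nth_cat iv => /= E.
  by move/negP: v2; apply; rewrite -E mem_nth.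
have := vE 0 (ltnW v1); have := vE 1 v1; rewrite !dvdn2 addn0 oddD /=.
by case: odd.
Qed.

(** Take [q] at the end of the first [v], [p] at the last 2 of [x] and [r] at the end of the second
    [v]: the block after [p] contains that [v], while [p - q <= size x]. *)
Lemma language_sandwich v x : L (v ++ x ++ v) -> binary v -> two \in x ->
  size v <= (size x).+1.
Proof.
move=> /languageE[w2 wP] bv x2.
case: (posnP (size v)) => [->//|v0].
(* Reversing [x] lets [seq_span] find its last 2. *)
have [s1 [s2 [xE s1p s2p]]] := seq_span (fun c => c != two) (rev x).
have {}xE : x = rev s2 ++ rev s1 by rewrite -rev_cat -xE revK.
case: s2 s2p xE => [_ xE|a s2 /negPn/eqP -> ].
  by move: x2; rewrite xE mem_rev => /(allP s1p); rewrite eqxx.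
rewrite rev_cons cat_rcons => xE.
have sx : size x = (size s1 + size s2).+1.
  by rewrite xE size_cat /= !size_rev addnS addnC.
set p := size v + size s2.
have E1 i : i < size v -> nth two (v ++ x ++ v) i = nth two v i.
  by move=> iv; rewrite nth_cat iv.
have E2 i : nth two (v ++ x ++ v) (p + i) = nth two (two :: rev s1 ++ v) i.
  by rewrite xE -!catA catA nth_cat size_cat size_rev ltnNge leq_addr /= addKn.
have := wP (size v).-1 p (p + size s1 + size v).
have -> : nth two (v ++ x ++ v) p = two by rewrite -(addn0 p) E2.
rewrite E1; last by lia.
have pv : (size v).-1 < p < p + size s1 + size v by lia.
have bq : nth two v (size v).-1 < 2.
  by apply: (allP bv); rewrite mem_nth// ltn_predL.
move=> /(_ pv bq erefl) H; suff : p + size s1 + size v + (size v).-1 <= p.*2.+1.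
  by lia.
apply: H => s sr.
have [i sE] : exists i, s = p + i.+1 by exists (s - p).-1; lia.
rewrite sE E2 /= nth_cat size_rev.
case: (ltnP i (size s1)) => [is1|s1i]; last first.
  have iv : i - size s1 < size v by lia.
  by apply: (allP bv); rewrite mem_nth.
have iE : nth two (rev s1) i != two.
  by apply: (allP s1p); rewrite -mem_rev mem_nth// size_rev.
have := w2 (p + i.+1); rewrite E2 /= nth_cat size_rev is1 leq_eqVlt.
by case/orP=> // /eqP i2; case/negP: iE; apply/eqP/val_inj.
Qed.

(** Glue [v], [v0], [v]: the part between the two copies of [v] contains 2 and has bounded length,
    so [language_sandwich] bounds [v]. *)
Lemma Wspecification_binary (G : set (seq 'I_n.+3)) v0 :
  Wspecification L G -> G v0 -> two \in v0 ->
  exists K, forall v, G v -> binary v -> size v <= K.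
Proof.
move=> [t Gt] Gv0 v02; exists (t + size v0 + t).+1 => v Gv bv.
have [i i3|g [gP]] := Gt 3 (fun i => if i == 1 then v0 else v) isT.
  by case: ifP.
rewrite [mkseq _ _]/= /= cats0 -!catA => vL.
have [_ g0] := gP 0 isT; have [_ g1] := gP 1 isT.
have := @language_sandwich v (g 0 ++ v0 ++ g 1).
rewrite -!catA => /(_ vL bv); rewrite !mem_cat v02 orbT /= => /(_ isT).
by move=> /leq_trans; apply; rewrite ltnS !size_cat addnA !leq_add.
Qed.

Lemma Wspecification_short_factors (G : set (seq 'I_n.+3)) :
  G `<=` L -> Wspecification L G ->
  exists (c : 'I_n.+3) K, forall s : seq (1.-tuple 'I_2),
    L (@block_word 1 2 isT c s) /\
    forall u v w, @block_word 1 2 isT c s = u ++ v ++ w -> G v -> size v <= K.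
Proof.
move=> GL Gspec.
have [[v0 Gv0 v02]|G2] := pselect (exists2 v0, G v0 & two \in v0).
  have [K GK] := Wspecification_binary Gspec Gv0 v02.
  exists zero, K => s.
  have bs : binary (@block_word 1 2 isT zero s).
    by apply: all_block_word => // i /=.
  split=> [|u v w sE Gv].
    by apply: head_word_language; exists 0, (@block_word 1 2 isT zero s).
  by apply: GK => //; move: bs; rewrite sE /binary !all_cat => /and3P[].
exists two, 1 => s; split; first exact: language_block_word.
move=> u v w sE Gv; apply: block_word_factor sE _.
by apply/negP => v2; apply: G2; exists v.
Qed.

(** A head word [2^i b] is coded by the bits [1^i 0 b]; the separator accounts for the extra bit. *)
Lemma head_word_count k : nb_words (head_word `|` [set [::]]) k <= 2 ^ k.+1.
Proof.
pose bit (b : bool) : 'I_n.+3 := if b then @Ordinal n.+3 1 isT else zero.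
pose f (t : k.+1.-tuple bool) :=
  nseq (index false t) two ++ map bit (drop (index false t).+1 t).
have := @nb_words_le _ _ f (head_word `|` [set [::]]) k.
rewrite card_tuple card_bool; apply=> x xH xk.
have [i [b [bb xE]]] : head_word x by case: xH => [//|->]; exists 0, [::].
pose t := nseq i true ++ false :: [seq a == 1 :> nat | a : 'I_n.+3 <- b].
have ts : size t == k.+1.
  by rewrite -xk xE !size_cat /= size_map !size_nseq addnS.
exists (Tuple ts); rewrite /f /=.
have -> : index false t = i.
  by rewrite index_cat size_nseq mem_nseq andbF /= addn0.
rewrite drop_cat size_nseq ltnNge leqnSn /= subSn// subnn /= drop0 xE -map_comp.
congr (_ ++ _); rewrite -[RHS]map_id; apply/eq_in_map => a /(allP bb) a2 /=.
by apply/val_inj; case: a a2 => [[|[|a]] ?].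
Qed.

End Example.

(** * Entropy estimates for the example *)

Section Main.
Local Open Scope ring_scope.
Variables (R : realType).

Lemma ln_natX (a k : nat) :
  (0 < a)%N -> ln (a ^ k)%N%:R = k%:R * ln a%:R :> R.
Proof. by move=> a0; rewrite natrX lnXn ?ltr0n// mulr_natl. Qed.

Lemma entropy_ge_short_middle (A : finType) (a0 : A) (D C : set (seq A))
    (K : nat) :
  (forall j, 2 ^ (8 * j) <= nb_words D (16 * j))%N ->
  (forall x, D x -> exists u v w,
    [/\ C u, C w, (size v <= K)%N & x = u ++ v ++ w]) ->
  ((ln 2 / 16 : R)%:E <= entropy R C)%E.
Proof.
move=> Dbig DC; rewrite leNgt; apply/negP => /entropy_lt[m Cm].
have [k mk] := short_middle_growth a0 m Dbig DC.
apply/negP; rewrite -leqNgt; set c := nb_words C k.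
apply: (@leq_trans (maxn 1 c ^ 16)%N); first by rewrite leq_exp2r// leq_maxr.
rewrite -(ler_nat R) -ler_ln ?posrE ?ltr0n ?expn_gt0 ?leq_max//.
rewrite !ln_natX ?leq_max//.
by have := Cm k mk; rewrite -/c; lra.
Qed.

Lemma hspec_gt0 (n : nat) : (0 < hspec R (thin_shift n))%E.
Proof.
apply: (@lt_le_trans _ _ (ln 2 / 16 : R)%:E).
  by rewrite lte_fin divr_gt0// ln_gt0// ltr1n.
apply: le_ereal_inf_tmp => _ [Cp [G [Cs [[CpL GL CsL dec] spec ->]]]].
(* Decomposing the empty word puts it in [Cp] and [Cs]. So [G] lies in its own thickening with
   [M = 1] and inherits specification. *)
have [u [v [w [Cpu Gv Csw uvw]]]] := dec [::] (or_introl erefl).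
have [u0 v0 w0] : [/\ u = [::], v = [::] & w = [::]].
  by case: u v w uvw {Cpu Gv Csw} => [|? ?] [|? ?] [|? ?].
rewrite u0 v0 w0 in Cpu Gv Csw.
have Gspec : Wspecification (language (thin_shift n)) G.
  have [t Gt] := spec 1%N isT; exists t => m f m2 Gf; apply: Gt => // i im.
  split; first exact/GL/Gf.
  by exists [::], (f i), [::]; split=> //; [exact: Gf|rewrite cats0].
have [c [K cK]] := Wspecification_short_factors GL Gspec.
apply: (@entropy_ge_short_middle _ (zero n)
  (range (@block_word n 1 2 isT c)) (Cp `|` Cs) K).
  (* A word of length [16 * j] consists of [8 * j] blocks of length 2, each with one free bit. *)
  move=> j; have := @nb_words_ge _ _
    (fun s : (8 * j).-tuple (1.-tuple 'I_2) => @block_word n 1 2 isT c s)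
    (range (@block_word n 1 2 isT c)) (16 * j).
  rewrite !card_tuple card_ord expn1; apply.
  - exact: block_word_inj.
  - by move=> s; rewrite size_block_word size_tuple; lia.
  - by move=> s; exists (tval s).
move=> _ [s _ <-]; have [sL sK] := cK s.
have [u' [v' [w' [Cpu' Gv' Csw' E]]]] := dec _ sL.
by exists u', v', w'; split=> //; [left|right|exact: sK E Gv'].
Qed.

Lemma htop_ge (n : nat) : ((ln 9 / 3 : R)%:E <= htop R (thin_shift n))%E.
Proof.
apply: entropy_ge => m; exists (m.+1 * 3)%N; split=> //; first by lia.
apply: (@le_trans _ _ (ln (9 ^ m.+1)%N%:R)).
  by rewrite ln_natX// natrM; lra.
rewrite ler_ln ?posrE ?ltr0n ?expn_gt0 ?leq_max// ler_nat.
apply: leq_trans (leq_maxr _ _).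
have := @nb_words_ge _ _
    (fun s : m.+1.-tuple (2.-tuple 'I_3) => @block_word n 2 3 isT (two n) s)
    (language (thin_shift n)) (m.+1 * 3)%N.
rewrite !card_tuple card_ord; apply.
- exact: block_word_inj.
- by move=> s; rewrite size_block_word size_tuple.
- by move=> s; exact: language_block_word.
Qed.

(* [2 ^ (k + 1) <= 2 ^ (19 k / 18)] for [k >= 18], and [2 ^ 19 < 9 ^ 6]. *)
Lemma hspec_le (n : nat) :
  (hspec R (thin_shift n) <= (19 / 18 * ln 2 : R)%:E)%E.
Proof.
apply: ge_ereal_inf; eexists.
  exists (@head_word n), (@tail_word n), [set [::]]; split; last by [].
    exact: decomposes_head_tail.
  exact: Wspecification_thicken.
apply: (@entropy_le _ _ _ _ 18) => // k k18.
apply: (@le_trans _ _ (ln (2 ^ k.+1)%N%:R)).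
  rewrite ler_ln ?posrE ?ltr0n ?expn_gt0 ?leq_max// ler_nat geq_max expn_gt0/=.
  exact: head_word_count.
rewrite ln_natX// -natr1.
have : 18 <= k%:R :> R by rewrite ler_nat.
have : 0 < ln 2 :> R by rewrite ln_gt0// ltr1n.
by nra.
Qed.

End Main.

Theorem theoremC (R : realType) (N : nat) (hN : (3 <= N)%N) :
  exists S : subshift 'I_N, (0 < hspec R S)%E /\ (hspec R S < htop R S)%E.
Proof.
case: N hN => [|[|[|n]]] // _; exists (thin_shift n).
split; first exact: hspec_gt0.
apply: le_lt_trans (hspec_le R n) _; apply: lt_le_trans (htop_ge R n).
rewrite lte_fin.
(* This is the required inequality between the two bounds, multiplied by 18. *)
have : (ln 2 *+ 19 < ln 9 *+ 6 :> R)%R.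
  by rewrite -!lnXn ?ltr0n// ltr_ln ?posrE ?exprn_gt0//; lra.
by lra.
Qed.
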